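(* For an integer $i\geq 1$, let $N_i$ be the poset obtained from the N-poset on $\{a,b,c,d\}$ by adding $i$ new elements $1,\dots,i$ and the cover relations $i<i-1<\cdots<1<a$. Then $N_i$ is a full semigroup poset for all $i\geq 1$, and $N_i$ is not a monoid poset for all $i\geq 2$.
   Context: The N-poset is the poset on four elements $a,b,c,d$ whose strict relations are exactly $a<b$, $c<b$, $c<d$. Thus in $N_i$ the elements $i<i-1<\dots<1<a<b$ form a chain, and the only other strict relations are $c<b$ and $c<d$. For a semigroup $T$ and a subsemigroup $S<T$ ($S=T$ allowed), define $t\leq_S t' :\iff \exists s\in S:\ ts=t'$ on $T$; when this is a partial order, $P(T,S)$ denotes $(T,\leq_S)$. A poset is a full semigroup poset if it is isomorphic to $P(S,S)$ for some semigroup $S$; it is a monoid poset if it is isomorphic to $P(N,M)$ for some monoid $N$ and submonoid $M<N$ (same neutral element). *)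

(* Defs.v *)
From HB Require Import structures.
From mathcomp Require Import all_boot all_order.
From Corelib Require Relation_Definitions.

Set Implicit Arguments.
Unset Strict Implicit.
Unset Printing Implicit Defensive.

Import Order.TTheory.

(* [Nnew k] is the added element written k + 1, so that [Nnew 0] is covered by
   [Na] and the index [k : 'I_i] decreases along the order. *)
Inductive Nposet (i : nat) : Type :=
  Na | Nb | Nc | Nd | Nnew of 'I_i.

Arguments Na {i}.
Arguments Nb {i}.
Arguments Nc {i}.
Arguments Nd {i}.
Arguments Nnew {i} k.

Section NposetTheory.
Variable i : nat.
Implicit Types x y : Nposet i.

Definition Nposet_code x : 'I_i + bool * bool :=
  match x with
  | Na => inr (false, false)
  | Nb => inr (false, true)
  | Nc => inr (true, false)
  | Nd => inr (true, true)
  | Nnew k => inl k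
  end.

Definition Nposet_decode (u : 'I_i + bool * bool) : Nposet i :=
  match u with
  | inr (false, false) => Na
  | inr (false, true) => Nb
  | inr (true, false) => Nc
  | inr (true, true) => Nd
  | inl k => Nnew k
  end.

Lemma Nposet_codeK : cancel Nposet_code Nposet_decode.
Proof. by case. Qed.

HB.instance Definition _ := Finite.copy (Nposet i) (can_type Nposet_codeK).

Definition Nposet_le x y : bool :=
  match x, y with
  | Na, (Na | Nb) => true
  | Nb, Nb => true
  | Nc, (Nb | Nc | Nd) => true
  | Nd, Nd => true
  | Nnew _, (Na | Nb) => true
  | Nnew k, Nnew l => l <= k
  | _, _ => false
  end.

Fact Nposet_le_refl : reflexive Nposet_le.
Proof. by case=> //= k; exact: leqnn. Qed.

Fact Nposet_le_anti : antisymmetric Nposet_le.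
Proof.
case=> [||||k] [||||l] //=.
by move/anti_leq/val_inj=> ->.
Qed.

Fact Nposet_le_trans : transitive Nposet_le.
Proof.
case=> [||||k] [||||l] [||||m] //= kl mk.
exact: leq_trans mk kl.
Qed.

Fact Nposet_display : Order.disp_t. Proof. exact: (Order.Disp tt tt). Qed.

HB.instance Definition _ :=
  Order.Le_isPOrder.Build Nposet_display (Nposet i)
    Nposet_le_refl Nposet_le_anti Nposet_le_trans.

Definition Nposet_cover : rel (Nposet i) := fun x y =>
  match x, y with
  | Na, Nb => true
  | Nc, Nb => true
  | Nc, Nd => true
  | Nnew k, Na => k == 0 :> nat
  | Nnew k, Nnew l => k == l.+1 :> nat
  | _, _ => false
  end.

Lemma Nposet_leE x y : (x <= y)%O = connect Nposet_cover x y.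
Proof.
change (Nposet_le x y = connect Nposet_cover x y).
apply/idP/idP; last first.
  case/connectP=> p; elim: p x => [|z p IHp] x /=.
    by move=> _ ->; exact: Nposet_le_refl.
  case/andP=> xz /IHp pz /pz {pz}.
  apply: Nposet_le_trans.
  by case: x z xz => [||||k] [||||l] //= /eqP->; exact: leqnSn.
have chain (d : nat) (k l : 'I_i) :
    k = l + d :> nat -> connect Nposet_cover (Nnew k) (Nnew l).
  elim: d k => [|d IHd] k; first by rewrite addn0 => /val_inj->.
  rewrite addnS => kE.
  have lt_i : l + d < i by rewrite -kE ltnW.
  apply: (@connect_trans _ _ (Nnew (Ordinal lt_i))); last exact: IHd.
  by apply: connect1; rewrite /= kE.
have ab : connect Nposet_cover Na Nb by exact: connect1.
have to_a k : connect Nposet_cover (Nnew k) Na.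
  have lt_i : 0 < i by exact: leq_ltn_trans (ltn_ord k).
  apply: (@connect_trans _ _ (Nnew (Ordinal lt_i))); last exact: connect1.
  exact: (chain k).
case: x y => [||||k] [||||l] //= kl; try exact: connect0; try exact: connect1.
- exact: connect_trans (to_a k) ab.
- by apply: (chain (k - l)); rewrite subnKC.
Qed.

End NposetTheory.

Section SemigroupOrder.
Local Open Scope group_scope.

Definition sg_le (T : semigroupType) (S : {pred T}) (t t' : T) : Prop :=
  exists2 s, s \in S & t * s = t'.

(* [P] is isomorphic to P(T, S); in particular P(T, S) has to exist, i.e.,
   [sg_le S] has to be a partial order on [T]. *)
Definition iso_sg_poset (d : Order.disp_t) (P : porderType d)
    (T : semigroupType) (S : {pred T}) : Prop :=
  Relation_Definitions.order T (sg_le S) /\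
  exists2 f : P -> T, bijective f
    & forall x y : P, (x <= y)%O <-> sg_le S (f x) (f y).

Definition full_semigroup_poset (d : Order.disp_t) (P : porderType d) : Prop :=
  exists S : semigroupType, iso_sg_poset P (predT : {pred S}).

Definition monoid_poset (d : Order.disp_t) (P : porderType d) : Prop :=
  exists (N : monoidType) (M : {pred N}),
    monoid_closed M /\ iso_sg_poset P M.

End SemigroupOrder.

(* Main.v *)
Require Import Defs.
From mathcomp Require Import all_boot all_order.
From HB Require Import structures.

(** The semigroup for the first part is explicit.  The chain
    [i < ... < 1 < a < b] is multiplied as a join-semilattice, with zero [b],
    and every product of a chain element by [c] or [d] is [b]; [d] is a left
    zero; left multiplication by [c] fixes [c] and [d] and sends the whole
    chain to [b].  This product is associative ([Nposet_mulA]), and the right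
    multiples of [x] are exactly the elements above [x]
    ([Nposet_mul_leP]).

    For the second part, suppose that [N_i] is P(N, M), with neutral element
    [e].  Since [e * M = M], the submonoid [M] is the up-set of [e], so that
    the up-set of any [x] is [x * M] ([monoid_poset_mul]).
    If [e] is not [c], then [M] is a chain for the order; multiplying [M] on
    the left by [c] preserves the order between the elements of [M], hence the
    up-set of [c] is a chain as well ([total_upset_transfer]), but it contains
    the incomparable elements [b] and [d].
    If [e = c], then [M = {b, c, d}] has only three elements, whereas the
    up-set [2 * M] of [2] contains the four elements [2], [1], [a] and [b]
    ([Nposet_unit_neq_c]). *)

Set Implicit Arguments.
Unset Strict Implicit.
Unset Printing Implicit Defensive.

Import Order.TTheory.

Section NposetSemigroup.
Variable i : nat.
Implicit Types x y z : Nposet i.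

(** A semigroup product on [N_i] whose right multiples give back the order.
    On the chain it is the join; between added elements this is the smaller
    index, since indices decrease along the order. *)
Definition Nposet_mul x y : Nposet i :=
  match x, y with
  | Na, (Na | Nnew _) => Na
  | Nnew _, Na => Na
  | Nnew k, Nnew l => if l <= k then Nnew l else Nnew k
  | Nc, (Nc | Nd) => y
  | Nd, _ => Nd
  | _, _ => Nb
  end.

Lemma Nposet_mulA : associative Nposet_mul.
Proof.
case=> [||||k] [||||l] [||||m] //=; try by case: leqP.
case: (leqP m l) => ml; case: (leqP l k) => lk /=.
- by rewrite ml (leq_trans ml lk).
- by [].
- by rewrite leqNgt ml.
- by rewrite leqNgt (ltn_trans lk ml).
Qed.

Lemma Nposet_mul_leP x y :
  reflect (exists z, Nposet_mul x z = y) (x <= y)%O.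
Proof.
change (reflect (exists z, Nposet_mul x z = y) (Nposet_le x y)).
apply: (iffP idP) => [xy | [z <-]].
  (* If [x <= y], then [y] itself is a factor taking [x] to [y]. *)
  by exists y; case: x y xy => [||||k] [||||l] //= ->.
case: x z => [||||k] [||||l] //=.
by case: leqP => //= _; exact: leqnn.
Qed.

HB.instance Definition _ := hasMul.Build (Nposet i) Nposet_mul.
HB.instance Definition _ := Magma_isSemigroup.Build (Nposet i) Nposet_mulA.

Lemma Nposet_full_semigroup_poset : full_semigroup_poset (Nposet i).
Proof.
have leP x y : (x <= y)%O <-> sg_le (predT : {pred Nposet i}) x y.
  split=> [/Nposet_mul_leP[z <-]|[z _ <-]]; first by exists z.
  by apply/Nposet_mul_leP; exists z.
exists (Nposet i); split; last by exists id => //; exists id.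
split=> [x|x y z /leP xy /leP yz|x y /leP xy /leP yx].
- exact/leP.
- exact/leP/(le_trans xy).
- by apply: le_anti; rewrite xy.
Qed.

End NposetSemigroup.

Section MonoidPoset.
Variables (d : Order.disp_t) (P : porderType d).

(** Transport of the monoid to the poset itself.  The submonoid becomes the
    up-set of the neutral element [e], because [s \in M] if and only if
    [1 <= s] in P(N, M). *)
Lemma monoid_poset_mul : monoid_poset P ->
  exists (e : P) (op : P -> P -> P),
    [/\ associative op, right_id e op
      & forall x y : P, (x <= y)%O <-> exists2 s, (e <= s)%O & op x s = y].
Proof.
case=> N [M [_ [_ [f [g fK gK] fle]]]].
exists (g 1%g), (fun x y => g (f x * f y)%g).
have eleP s : (g 1%g <= s)%O <-> f s \in M.
  split=> [/fle[t tM]|sM]; first by rewrite gK mul1g => <-.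
  by apply/fle; exists (f s); rewrite ?gK ?mul1g.
split=> [x y z|x|x y]; first by rewrite !gK mulgA.
  by rewrite gK mulg1 fK.
split=> [/fle[s sM xsy]|[s /eleP sM <-]].
  by exists (g s); [apply/eleP; rewrite gK | rewrite gK xsy fK].
by apply/fle; exists (f s); rewrite ?gK.
Qed.

Variables (e : P) (op : P -> P -> P).
Hypothesis opA : associative op.
Hypothesis op_leP :
  forall x y : P, (x <= y)%O <-> exists2 s, (e <= s)%O & op x s = y.

(** If [y = x * s] and [z = x * t], then [s <= t] implies [y <= z]: left
    multiplication by [x] is monotone. *)
Lemma total_upset_transfer :
    (forall s t : P, e <= s -> e <= t -> (s <= t) || (t <= s))%O ->
  forall x y z : P, (x <= y -> x <= z -> (y <= z) || (z <= y))%O.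
Proof.
have mono (x s t : P) : (s <= t -> op x s <= op x t)%O.
  by case/op_leP=> u eu <-; apply/op_leP; exists u; rewrite ?opA.
move=> e_total x y z /op_leP[s es <-] /op_leP[t et <-].
by have /orP[/mono-> | /mono->] := e_total s t es et; rewrite ?orbT.
Qed.

End MonoidPoset.

Lemma Nposet_upset_total i (e s t : Nposet i) :
  e <> Nc -> (e <= s -> e <= t -> (s <= t) || (t <= s))%O.
Proof.
move=> eNc.
change (Nposet_le e s -> Nposet_le e t -> Nposet_le s t || Nposet_le t s).
case: e s t eNc => [||||k] [||||l] [||||m] //= _ _ _.
exact: leq_total.
Qed.

(** The bound on [i] makes [2] an element of the poset. *)
Lemma Nposet_unit_neq_c i (e : Nposet i)
    (op : Nposet i -> Nposet i -> Nposet i) :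
    1 < i -> right_id e op ->
    (forall x y : Nposet i,
       (x <= y)%O <-> exists2 s, (e <= s)%O & op x s = y) ->
  e <> Nc.
Proof.
move=> i_gt1 op1 op_leP e_c; rewrite {e}e_c in op1 op_leP.
pose n1 : Nposet i := Nnew (Ordinal (ltnW i_gt1)).
pose n2 : Nposet i := Nnew (Ordinal i_gt1).
(* The neutral element [c] takes [n2] to itself, so the other elements above
   [n2] come from [b] and [d]: there are at most two of them, but [n1], [a]
   and [b] are three. *)
have above y : (n2 <= y)%O -> y <> n2 -> op n2 Nb = y \/ op n2 Nd = y.
  case/op_leP=> s; case: s => // _; rewrite ?op1; by [left | right | move=> ->].
have n1E : op n2 Nb = n1 \/ op n2 Nd = n1 by exact: above.
have aE : op n2 Nb = Na \/ op n2 Nd = Na by exact: above.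
have bE : op n2 Nb = Nb \/ op n2 Nd = Nb by exact: above.
rewrite /n1 in n1E.
by case: n1E aE bE => n1E [] aE [] bE; congruence.
Qed.

Theorem theorem3p5 :
  (forall i : nat, 1 <= i -> full_semigroup_poset (Nposet i)) /\
  (forall i : nat, 2 <= i -> ~ monoid_poset (Nposet i)).
Proof.
split=> i i_gt; first exact: Nposet_full_semigroup_poset.
case/monoid_poset_mul=> e [op [opA op1 op_leP]].
have eNc := Nposet_unit_neq_c i_gt op1 op_leP.
have e_total s t := @Nposet_upset_total i e s t eNc.
by have := total_upset_transfer opA op_leP e_total (isT : Nc <= Nb)%O
  (isT : Nc <= Nd)%O.
Qed.
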